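(* There exists a finitely generated uniformly non-amenable group $G$ (i.e. $\alpha(G)>0$) which contains no non-abelian free subgroup.
   Context: For a finitely generated group $G$, consider the left regular representation of $G$ on the Hilbert space $L^2(G)$ of square-summable functions on $G$, $(xv)(g)=v(x^{-1}g)$. For a finite generating set $X$ of $G$, $\alpha(G,X)$ is the maximal $\varepsilon\ge 0$ such that for every $v\in L^2(G)$ with $\|v\|=1$ there exists $x\in X$ with $\|xv-v\|\ge\varepsilon$. Put $\alpha(G)=\inf_X\alpha(G,X)$, the infimum being over all finite generating sets $X$ of $G$. The group $G$ is called uniformly non-amenable if $\alpha(G)>0$. *)

(* Defs.v *)
From mathcomp Require Import all_boot all_order all_algebra.
From mathcomp Require Import complex.
From mathcomp Require Import all_classical all_reals all_analysis.

Set Implicit Arguments.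
Unset Strict Implicit.
Unset Printing Implicit Defensive.

Import Order.TTheory GRing.Theory Num.Theory.

Local Open Scope classical_set_scope.
Local Open Scope ring_scope.

Definition is_subgroup (G : groupType) (H : set G) : Prop :=
  group_closed (mem H).

Definition generates (G : groupType) (X : set G) : Prop :=
  smallest (@is_subgroup G) X = setT.

Definition finitely_generated (G : groupType) : Prop :=
  exists X : set G, finite_set X /\ generates X.

(* The letter (s, false) stands for s and (s, true) for s^-1. *)
Definition word_eval (G : groupType) (w : seq (G * bool)) : G :=
  (\prod_(l <- w) (if l.2 then l.1^-1 else l.1))%g.

(* Reduced: no two adjacent letters s, s^-1 or s^-1, s. *)
Definition reduced_words (G : groupType) (S : set G) : set (seq (G * bool)) :=
  [set w : seq (G * bool) | (forall l, l \in w -> S l.1) /\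
           sorted (fun l m => (l.1 == m.1) ==> (l.2 == m.2)) w].

(* H is isomorphic to the free group on S, realised as the reduced words
   over S, by the evaluation map. *)
Definition free_on (G : groupType) (S H : set G) : Prop :=
  set_bij (reduced_words S) H (@word_eval G).

Definition is_free (G : groupType) (H : set G) : Prop :=
  exists S : set G, free_on S H.

Definition is_abelian (G : groupType) (H : set G) : Prop :=
  forall x y, H x -> H y -> commute x y.

Definition no_nonabelian_free_subgroup (G : groupType) : Prop :=
  forall H : set G, is_subgroup H -> is_free H -> is_abelian H.

Section L2.
Variables (R : realType) (G : groupType).
Implicit Types (v : G -> R[i]) (X : set G).

Definition l2sqnorm v : \bar R :=
  (\esum_(g in [set: G]) (ComplexField.Normc.normc (v g) ^+ 2)%:E)%E.

Definition L2 : set (G -> R[i]) := [set v | (l2sqnorm v < +oo)%E].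

(* Meaningful for v in L2 only: fine sends +oo to 0. *)
Definition l2norm v : R := Num.sqrt (fine (l2sqnorm v)).

Definition lreg (x : G) v : G -> R[i] := fun g => v (x^-1 * g)%g.

Definition moves_by X (e : R) : Prop :=
  forall v, L2 v -> l2norm v = 1 ->
    exists2 x, X x & e <= l2norm (fun g => lreg x v g - v g).

(* This supremum is a maximum, see alphaX_max.  The empty set, which generates
   the trivial group only, gets the value sup set0 = 0. *)
Definition alphaX X : R := sup [set e | 0 <= e /\ moves_by X e].

Definition alpha : R :=
  inf [set alphaX X | X in [set X : set G | finite_set X /\ generates X]].

Lemma l2norm_ge0 v : 0 <= l2norm v.
Proof. exact: sqrtr_ge0. Qed.

Lemma L2_unit_vector : exists2 v, L2 v & l2norm v = 1.
Proof.
pose v (g : G) : R[i] := if g == 1%g then 1 else 0.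
have E : l2sqnorm v = 1%E.
  rewrite /l2sqnorm (esumID [set 1%g]); last first.
    by move=> i _; rewrite lee_fin sqr_ge0.
  rewrite setTI esum_set1; last by rewrite lee_fin sqr_ge0.
  rewrite esum1 ?adde0; last first.
    move=> i [_ /= i1]; rewrite /v; case: eqP => // _.
    by rewrite ComplexField.Normc.normc0 expr0n.
  by rewrite /v eqxx ComplexField.Normc.normc1 expr1n.
exists v; first by rewrite /L2 /= E ltry.
by rewrite /l2norm E /= sqrtr1.
Qed.

Lemma alphaX_max X : finite_set X -> X !=set0 ->
  [/\ 0 <= alphaX X, moves_by X (alphaX X) &
      forall e, 0 <= e -> moves_by X e -> e <= alphaX X].
Proof.
move=> finX [x0 Xx0]; set A := [set e | 0 <= e /\ moves_by X e].
have [s sX] := (finite_seqP X).1 finX.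
have A0 : A 0 by split=> // v _ _; exists x0 => //; exact: l2norm_ge0.
pose N v x := l2norm (fun g => lreg x v g - v g).
pose M v := \big[Num.max/0]_(x <- s) N v x.
have AM v : L2 v -> l2norm v = 1 -> ubound A (M v).
  move=> v2 v1 e [_ /(_ v v2 v1)[x Xx ex]]; apply: (le_trans ex).
  by rewrite /M; apply: (Order.TotalTheory.le_bigmax_seq _ x xpredT) => //; move: Xx; rewrite sX.
have ubA : has_ubound A.
  by have [v v2 v1] := L2_unit_vector; exists (M v); exact: AM.
have leA e : A e -> e <= alphaX X by exact: ub_le_sup.
split; [exact: leA| |by move=> e e0 eX; apply: leA].
move=> v v2 v1.
have : alphaX X <= M v by apply: ge_sup; [exists 0 | exact: AM].
have : exists2 x, X x & M v <= N v x.
  have : {subset s <= [pred x | `[< X x >]]}.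
    by move=> x xs; apply/asboolP; rewrite sX.
  rewrite /M; elim: (s) => [_|y t IH sub].
    by exists x0 => //; rewrite big_nil; exact: l2norm_ge0.
  rewrite big_cons.
  have [|x Xx tx] := IH; first by move=> z zt; apply: sub; rewrite inE zt orbT.
  have Xy : X y by apply/asboolP; apply: (sub y); rewrite inE eqxx.
  have [yx|xy] := leP (N v y) (N v x); [exists x => //|exists y => //].
    by rewrite ge_max yx.
  by rewrite ge_max lexx (le_trans tx) // ltW.
by move=> [x Xx Mx] aM; exists x => //; exact: le_trans Mx.
Qed.

End L2.

Definition uniformly_nonamenable (R : realType) (G : groupType) : Prop :=
  0 < alpha R G.

(* Main.v *)
(* The group is the largest residually finite group on two generators in which
   the j-th word has order dividing 2^(j+2).  It is torsion, hence contains no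
   free subgroup other than the trivial one.

   Non-amenability comes from the positive 2-deficiency (Schlage-Puchta).  Let Q
   be a finite quotient in which the j-th word has order 2^i.  On the F_2-valued
   1-cochains of the Cayley graph of Q, the conjugates of the j-th relator impose
   no condition if i < j + 2, because the relator is then a square of a loop, and
   at most |Q| / 2^(j+2) conditions if i = j + 2.  So a space of cocycles of
   dimension at least 2 |Q| - |Q| / 2 survives; these cocycles live on the group
   itself, since they define finite extensions of Q satisfying the relations.

   This dimension does not depend on the generators: for any finite generating
   set X, at least 3/2 |Q| edges of Q x X have linearly independent cocycle
   values.  On a finite subset A of the group that injects into Q a cocycle is a
   coboundary, so at most |A| independent edges lie inside a copy of A.
   Averaging over the copies of A, some x in X satisfies
   sum_y min (f y, f (y x)) <= 2/3 sum_y f y for f >= 0 supported on A, and the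
   constant does not depend on |X|.  Applied to f y = |v (y^-1)|^2 this shows
   that x moves the unit vector v by at least 1/4. *)

From HB Require Import structures.
Require Import Defs.
From mathcomp Require Import all_boot all_order all_algebra.
From mathcomp Require Import all_fingroup cyclic.
From mathcomp Require Import complex.
From mathcomp Require Import all_classical all_reals all_analysis.
From mathcomp Require Import lra zify.

Set Implicit Arguments.
Unset Strict Implicit.
Unset Printing Implicit Defensive.

Import Order.TTheory GRing.Theory Num.Theory.

Local Open Scope classical_set_scope.
Local Open Scope ring_scope.

(** * Independent edges of a cocycle *)

(** An invertible maximal minor has a nonzero term in its Leibniz expansion; the permutation of that
    term gives the choice. *)
Lemma row_free_sdr (F : fieldType) m n (M : 'M[F]_(m, n)) : row_free M ->
  exists2 s : 'I_m -> 'I_n, injective s & forall i, M i (s i) != 0.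
Proof.
move=> freeM; have fullM : row_full M^T by rewrite /row_full mxrank_tr.
have := fullrowsub_unit fullM; rewrite unitmxE unitfE => detN0.
have [p pN0] : exists p : 'S_m, \prod_i M (p i) (fullrankfun fullM i) != 0.
  apply: contrapT => /forallNP noperm; case/eqP: detN0; apply: big1 => p _.
  have /negP := noperm p; rewrite negbK => /eqP p0.
  rewrite (eq_bigr (fun i => M (p i) (fullrankfun fullM i))) ?p0 ?mulr0//.
  by move=> i _; rewrite !mxE.
exists (fun i => fullrankfun fullM (p^-1%g i)).
  by move=> i j /fullrankfun_inj /perm_inj.
move=> i; apply: contraNneq pN0 => Mi0.
by apply/prodf_eq0; exists (p^-1%g i) => //; rewrite permKV Mi0.
Qed.

Lemma row_free_rowsub (F : fieldType) m n k (W : 'M[F]_(m, n))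
    (f : 'I_k -> 'I_m) : row_free W -> injective f -> row_free (rowsub f W).
Proof.
move=> freeW f_inj; rewrite rowsubE -row_leq_rank mxrankMfree// row_leq_rank.
apply/row_freeP; exists (rowsub f 1%:M)^T; apply/matrixP => i j; rewrite !mxE.
rewrite (bigD1 (f i))//= !mxE eqxx mul1r big1 ?addr0 => [|l].
  by rewrite (inj_eq f_inj) eq_sym.
by rewrite !mxE eq_sym => /negPf ->; rewrite mul0r.
Qed.

(** Edges with independent potential differences form a forest, so each can be assigned an endpoint
    of its own, where [f] is at least the minimum over the edge. *)
Lemma sum_min_le (R : realFieldType) (F : fieldType) m k n
    (s t : 'I_m -> 'I_k) (U : 'I_k -> 'rV[F]_n) (f : 'I_k -> R) :
  row_free (\matrix_(i < m) (U (t i) - U (s i))) -> (forall j, 0 <= f j) ->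
  \sum_(i < m) Num.min (f (s i)) (f (t i)) <= \sum_j f j.
Proof.
move=> free_st f0.
pose D : 'M[F]_(m, k) := \matrix_i (delta_mx 0 (t i) - delta_mx 0 (s i)).
(* Multiplying the incidence matrix [D] by the potentials [U] gives the differences, so a dependence
   in [D] would persist there. *)
have freeD : row_free D.
  rewrite -row_leq_rank; move: free_st; rewrite -row_leq_rank => /leq_trans; apply.
  rewrite [X in \rank X](_ : _ = D *m \matrix_j U j); first exact: mxrankM_maxl.
  apply/row_matrixP => i; rewrite row_mul !rowK mulmxBl -!rowE !rowK.
  by [].
have [p p_inj Dp] := row_free_sdr freeD.
apply: (@le_trans _ _ (\sum_i f (p i))).
  apply: ler_sum => i _; have := Dp i; rewrite !mxE eqxx /=.
  have [->|_] := eqVneq (p i) (t i); first by rewrite ge_min lexx orbT.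
  have [->|_] := eqVneq (p i) (s i); first by rewrite ge_min lexx.
  by rewrite subrr eqxx.
have -> : \sum_i f (p i) = \sum_(j in imset p (mem predT)) f j.
  by rewrite big_imset// => x y _ _; exact: p_inj.
by rewrite [leRHS](bigID (mem (imset p (mem predT))))/= lerDl sumr_ge0.
Qed.

Lemma generates_ind (G : groupType) (X S : set G) : generates X ->
  is_subgroup S -> X `<=` S -> forall x, S x.
Proof.
move=> genX subS XS x; have : smallest (@is_subgroup G) X x by rewrite genX.
by apply; split.
Qed.

Section Cocycle.
Variables (G : groupType) (Q : finGroupType) (p : G -> Q).
Variables (F : fieldType) (n : nat) (P : Q -> G -> 'rV[F]_n).
Hypothesis pM : forall x y, p (x * y)%g = (p x * p y)%g.
Hypothesis PM : forall g x y, P g (x * y)%g = P g x + P (g * p x)%g y.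

Lemma cocycle1 g : P g 1%g = 0.
Proof.
have p1 : p 1%g = 1%g by apply: (mulgI (p 1%g)); rewrite -pM !mulg1.
by apply: (addrI (P g 1%g)); have := PM g 1 1; rewrite p1 !mulg1 addr0 => {1}<-.
Qed.

(** By the cocycle identity, the elements whose values all lie in the row space of [M] form a
    subgroup. Hence the rank does not depend on the generators. *)
Lemma cocycle_span (X : set G) m (M : 'M[F]_(m, n)) : generates X ->
  (forall g x, X x -> (P g x <= M)%MS) -> forall g x, (P g x <= M)%MS.
Proof.
move=> genX XM g x; pose S := [set x | forall g, (P g x <= M)%MS].
suff : S x by apply.
apply: (generates_ind genX) => [|y Xy h]; last exact: XM.
split=> [|y z /set_mem Sy /set_mem Sz]; apply/mem_set => h.
  by rewrite cocycle1 sub0mx.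
rewrite PM addmx_sub//; have := PM (h * p y)%g z^-1%g z.
rewrite mulVg cocycle1 => /esym/eqP; rewrite addr_eq0 => /eqP ->.
by rewrite eqmx_opp.
Qed.

End Cocycle.

(* At least [3/2 #|Q|] edges [(g, x)] have linearly independent cocycle values.
   On each of the [#|Q|] translated copies of [A] in [Q] the cocycle is a
   coboundary, so these edges can be matched injectively to their endpoints. *)
Lemma overlap_le (R : realFieldType) (G : groupType) (Q : finGroupType)
    (p : G -> Q) (F : fieldType) n (P : Q -> G -> 'rV[F]_n) (A : seq G)
    (X : set G) (f : G -> R) :
  (forall x y, p (x * y)%g = (p x * p y)%g) ->
  (forall g x y, P g (x * y)%g = P g x + P (g * p x)%g y) ->
  (forall m (M : 'M[F]_(m, n)), (forall g x, (P g x <= M)%MS) ->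
     (3 * #|Q| <= 2 * \rank M)%N) ->
  uniq A -> {in A &, injective p} ->
  finite_set X -> generates X -> (forall y, 0 <= f y) ->
  exists2 x, X x & \sum_(y <- A | (y * x)%g \in A) Num.min (f y) (f (y * x)%g)
                     <= 2 / 3 * \sum_(y <- A) f y.
Proof.
move=> pM PM rankP uniqA p_inj finX genX f0.
have [sX XE] := (finite_seqP X).1 finX.
pose k := size A; pose ga := tnth (in_tuple A) : 'I_k -> G.
have gaA j : ga j \in A by exact: mem_tnth.
have ga_inj : injective ga by move=> i j /(tuple_uniqP (in_tuple A) uniqA).
pose T := (Q * 'I_(size sX))%type.
pose xi (e : T) := tnth (in_tuple sX) e.2.
have Xxi e : X (xi e) by rewrite XE; exact: mem_tnth.
pose M : 'M[F]_(#|{: T}|, n) := \matrix_i P (enum_val i).1 (xi (enum_val i)).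
have rkM : (3 * #|Q| <= 2 * \rank M)%N.
  apply: rankP; apply: (cocycle_span pM PM genX) => g x; rewrite XE => xX.
  have [j ->] : exists j, x = tnth (in_tuple sX) j by exact/tnthP.
  have := row_sub (enum_rank (g, j) : 'I_#|{: T}|) M.
  by rewrite rowK enum_rankK.
pose r := \rank M.
pose e (i : 'I_r) : T := enum_val (maxrankfun M i).
have freeW := maxrowsub_free M.
pose S := \sum_j f (ga j).
have SE : \sum_(y <- A) f y = S by rewrite big_tnth.
(* These are the chosen edges that are images of edges inside [A] under left translation by [h]
   after [p], with the indices of their endpoints. *)
pose E h := [set z : 'I_r * ('I_k * 'I_k) |
  ((h * p (ga z.2.1))%g == (e z.1).1) && ((ga z.2.1 * xi (e z.1))%g == ga z.2.2)]%SET.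
have E_le h : \sum_(z in E h) Num.min (f (ga z.2.1)) (f (ga z.2.2)) <= S.
  rewrite big_enum_val/=.
  apply: (@sum_min_le _ F _ _ n (fun i => (enum_val i).2.1)
    (fun i => (enum_val i).2.2) (fun j => P h (ga j)) (fun j => f (ga j))) => //.
  pose c (i : 'I_#|E h|) := (enum_val i).1.
  have Ec i : P h (ga (enum_val i).2.2) - P h (ga (enum_val i).2.1) =
              P (e (c i)).1 (xi (e (c i))).
    have := enum_valP i; rewrite inE => /andP[/eqP <- /eqP <-].
    by rewrite PM addrC addKr.
  have c_inj : injective c.
    move=> i j cij; apply: enum_val_inj; move: cij (enum_valP i) (enum_valP j).
    rewrite /c; case: (enum_val i) (enum_val j) => [a [b b']] [a' [d d']] /= <-.
    rewrite !inE/= => /andP[/eqP h1 /eqP h2] /andP[/eqP h3 /eqP h4].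
    have bd : b = d by apply/ga_inj/p_inj => //; apply: (mulgI h); rewrite h1.
    by congr (_, (_, _)) => //; apply: ga_inj; rewrite -h2 -h4 bd.
  rewrite (_ : \matrix_i _ = rowsub c (rowsub (maxrankfun M) M)).
    exact: row_free_rowsub.
  by apply/row_matrixP => i; rewrite rowK !row_rowsub rowK Ec.
pose m x := \sum_(y <- A | (y * x)%g \in A) Num.min (f y) (f (y * x)%g).
(* Double counting: for a given edge and a given [y] in [A], exactly one [h] carries [p y] to the
   source of the edge. *)
have sumE : \sum_h \sum_(z in E h) Num.min (f (ga z.2.1)) (f (ga z.2.2)) =
            \sum_i m (xi (e i)).
  rewrite (exchange_big_dep predT)//=.
  transitivity (\sum_i \sum_j \sum_l \sum_(h | (i, (j, l)) \in E h)
      Num.min (f (ga j)) (f (ga l))).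
    under [RHS]eq_bigr do rewrite pair_bigA.
    by rewrite pair_bigA; apply: eq_bigr => -[i [j l]].
  apply: eq_bigr => i _; rewrite /m [RHS]big_tnth [RHS]big_mkcond/=.
  apply: eq_bigr => j _; rewrite -/(ga j).
  have hE h l : ((i, (j, l)) \in E h) =
      (h == ((e i).1 * (p (ga j))^-1)%g) && ((ga j * xi (e i))%g == ga l).
    by rewrite inE /= -(can2_eq (mulgK _) (mulgKV _)).
  under eq_bigr => l _ do under eq_bigl => h do rewrite hE.
  case: ifPn => yA.
    have [l lE] : exists l, (ga j * xi (e i))%g = ga l.
      by exact/(@tnthP _ _ (in_tuple A)).
    rewrite (bigD1 l)//= (big_pred1 ((e i).1 * (p (ga j))^-1)%g) => [|h].
      rewrite big1 ?addr0 -?lE// => l' l'l; rewrite big_pred0// => h.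
      by rewrite lE (inj_eq ga_inj) [l == l']eq_sym (negPf l'l) andbF.
    by rewrite /= lE eqxx andbT.
  apply: big1 => l _; rewrite big_pred0// => h.
  by apply: contraNF yA => /andP[_ /eqP ->]; exact: gaA.
have : \sum_i m (xi (e i)) <= #|Q|%:R * S.
  by rewrite -sumE mulr_natl -sumr_const; exact: ler_sum.
have S0 : 0 <= S by apply: sumr_ge0.
apply: contraPP => /forall2NP noX; apply/negP; rewrite -ltNge.
have mlt i : 2 / 3 * S < m (xi (e i)).
  by have [//|/negP] := noX (xi (e i)); rewrite -ltNge SE.
have Q0 : (0 < #|Q|)%N by apply/card_gt0P; exists 1%g.
(* A nonempty sum keeps the inequality strict, even when [S = 0]. *)
have r0 : (0 < r)%N by move: rkM; rewrite -/r; lia.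
apply: (@le_lt_trans _ _ (\sum_(i < r) (2 / 3 * S))).
  rewrite sumr_const card_ord -[leRHS]mulr_natl mulrA ler_wpM2r//.
  have : (3 * #|Q|)%:R <= (2 * r)%:R :> R by rewrite ler_nat.
  by rewrite !natrM; lra.
apply: ltr_sum => //; apply/hasP; exists (Ordinal r0) => //; exact: mem_index_enum.
Qed.

(** * Cocycles killing the relators *)

Section Words.
Variables (Q : finGroupType) (a : bool -> Q).

Definition weval (w : seq bool) : Q := (\prod_(b <- w) a b)%g.

Lemma weval_cat w1 w2 : weval (w1 ++ w2) = (weval w1 * weval w2)%g.
Proof. exact: big_cat. Qed.

Definition wpow m (w : seq bool) := iter m (cat w) [::].

Lemma wpowD m1 m2 w : wpow (m1 + m2) w = wpow m1 w ++ wpow m2 w.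
Proof. by elim: m1 => //= m1 IH; rewrite IH catA. Qed.

Lemma weval_pow m w : weval (wpow m w) = (weval w ^+ m)%g.
Proof.
elim: m => [|m IH]; first by rewrite /weval big_nil.
by rewrite [wpow _ _]/= weval_cat IH expgS.
Qed.

(** Every word [w] is the root of index [pickle w]; an index coding no word yields the empty word
    and a trivial relation. *)
Definition rel_root (j : nat) : seq bool := odflt [::] (unpickle j).

Definition satisfies_relations : Prop :=
  forall j, (weval (rel_root j) ^+ (2 ^ j.+2) = 1)%g.

Section Path.
Variables (V : zmodType) (d : Q -> bool -> V).

(** The integral of the 1-cochain [d] along the path labelled [w] from [g] in the Cayley graph. *)
Fixpoint path_sum (g : Q) (w : seq bool) : V :=
  if w is b :: w' then d g b + path_sum (g * a b)%g w' else 0.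

Lemma path_sum_cat g w1 w2 :
  path_sum g (w1 ++ w2) = path_sum g w1 + path_sum (g * weval w1)%g w2.
Proof.
elim: w1 g => [|b w1 IH] g /=; first by rewrite /weval big_nil mulg1 add0r.
by rewrite IH addrA /weval big_cons mulgA.
Qed.

(** Moving the base point along [w] rotates the loop: its first copy of [w] becomes the last. *)
Lemma path_sum_shift g w m t : (weval w ^+ m = 1)%g ->
  path_sum (g * weval w ^+ t)%g (wpow m w) = path_sum g (wpow m w).
Proof.
move=> wm1; elim: t g => [|t IH] g; first by rewrite expg0 mulg1.
rewrite expgS mulgA IH; apply: (addrI (path_sum g w)).
rewrite -path_sum_cat -[w ++ wpow m w]/(wpow m.+1 w) -addn1 wpowD.
by rewrite path_sum_cat weval_pow wm1 mulg1 /= cats0 addrC.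
Qed.

End Path.

Lemma path_sum_mulmx (F : fieldType) n k (d : Q -> bool -> 'rV[F]_n)
    (T : 'M[F]_(n, k)) g w :
  path_sum (fun g b => d g b *m T) g w = path_sum d g w *m T.
Proof. by elim: w g => [|b w IH] g /=; rewrite ?mul0mx// IH mulmxDl. Qed.

End Words.

Lemma mxrank_le_card (F : fieldType) (C : finType) m n (f : 'I_m -> C)
    (D : {set C}) (U : C -> 'rV[F]_n) : (forall i, f i \in D) ->
  (\rank (\matrix_i U (f i)) <= #|D|)%N.
Proof.
move=> fD; pose M := \matrix_(c < #|D|) U (enum_val c).
apply: leq_trans (rank_leq_row M); apply/mxrankS/row_subP => i.
rewrite rowK; have := row_sub (enum_rank_in (fD i) (f i)) M.
by rewrite rowK enum_rankK_in.
Qed.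

Lemma char2_rV n (x : 'rV['F_2]_n) : x + x = 0.
Proof.
by apply/rowP => i; rewrite !mxE -mulr2n -mulr_natl pchar_Fp_0 ?mul0r.
Qed.

Section UniversalCocycle.
Variables (Q : finGroupType) (a : bool -> Q).
Hypothesis relQ : satisfies_relations a.

Local Notation n := #|{: Q * bool}|.

(** The universal cochain: every other one is its image under a linear map. *)
Let delta (g : Q) (b : bool) : 'rV['F_2]_n := delta_mx 0 (enum_rank (g, b)).

Let rel_mx j : 'M['F_2]_(#|Q|, n) :=
  \matrix_i path_sum a delta (enum_val i) (wpow (2 ^ j.+2) (rel_root j)).

(* If the image [u] of the root has order less than [2^(j+2)], the relator is a
   square of a loop and imposes nothing modulo 2; otherwise its loops based at
   the points of a coset of [<[u]>] coincide. *)
Lemma rank_rel_mx j : (2 ^ j.+2 * \rank (rel_mx j) <= #|Q|)%N.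
Proof.
set w := rel_root j; set u := weval a w.
have u1 : (u ^+ (2 ^ j.+2) = 1)%g by exact: relQ.
have [i ij uE] : exists2 i, (i <= j.+2)%N & #[u]%g = (2 ^ i)%N.
  by apply/(dvdn_pfactor _ _ (isT : prime 2)); rewrite order_dvdn u1.
move: ij; rewrite leq_eqVlt => /orP[/eqP ij|ij]; last first.
  rewrite (_ : rel_mx j = 0) ?mxrank0 ?muln0//.
  apply/row_matrixP => k; rewrite rowK row0 expnS mul2n -addnn wpowD path_sum_cat.
  rewrite weval_pow -/u (_ : u ^+ _ = 1)%g ?mulg1 ?char2_rV//.
  by apply/eqP; rewrite -order_dvdn uE dvdn_exp2l.
have QE : #|Q| = (2 ^ j.+2 * #|[set: Q]%G : <[u]>|%g)%N.
  by rewrite -cardsT -(Lagrange (finset.subsetT <[u]>%G)) -ij -uE.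
rewrite [leqRHS]QE leq_mul2l; apply/orP; right; rewrite -card_lcosets.
pose U (B : {set Q}) := path_sum a delta (repr B) (wpow (2 ^ j.+2) w).
rewrite (_ : rel_mx j = \matrix_i U (enum_val i *: <[u]>)%g).
  by apply: mxrank_le_card => k; apply/lcosetsP; exists (enum_val k).
apply/row_matrixP => k; rewrite !rowK /U.
have /lcosetP[x /cycleP[t ->] ->] := mem_repr _ (lcoset_refl <[u]>%G (enum_val k)).
by rewrite path_sum_shift.
Qed.

(** The universal cochain is taken modulo the span of all relator loops. *)
Lemma universal_cocycle :
  exists (d : Q -> bool -> 'rV['F_2]_n),
    (forall g j, path_sum a d g (wpow (2 ^ j.+2) (rel_root j)) = 0) /\
    (forall m (M : 'M['F_2]_(m, n)), (forall g b, (d g b <= M)%MS) ->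
       (3 * #|Q| <= 2 * \rank M)%N).
Proof.
pose S J := (\sum_(j < J) <<rel_mx j>>)%MS.
(* Without denominators: the rank of [S J] is at most [#|Q| * (1/2 - 1/2^(J+1))]. *)
have rkS J : (2 ^ J.+1 * \rank (S J) + #|Q| <= 2 ^ J * #|Q|)%N.
  elim: J => [|J IH]; first by rewrite /S big_ord0 mxrank0 muln0 mul1n.
  have := rank_rel_mx J.
  have : (\rank (S J.+1) <= \rank (S J) + \rank (rel_mx J))%N.
    rewrite /S big_ord_recr/= -[X in (_ <= _ + X)%N](mxrank_gen (rel_mx J)).
    exact: mxrank_adds_leqif.
  move: IH; rewrite !expnS; move: (2 ^ J)%N => N; nia.
set T := cokermx (S #|Q|); exists (fun g b => delta g b *m T); split.
  move=> g j; rewrite path_sum_mulmx; apply/eqP.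
  have gE : path_sum a delta g (wpow (2 ^ j.+2) (rel_root j)) =
      row (enum_rank g) (rel_mx j) by rewrite rowK enum_rankK.
  (* For [j >= #|Q|] the bound of [rank_rel_mx] is below 1, so finitely many relators suffice. *)
  rewrite gE -submxE; have [jQ|Qj] := ltnP j #|Q|.
    apply: submx_trans (row_sub _ _) _.
    by apply: (sumsmx_sup (Ordinal jQ)) => //; rewrite genmxE.
  rewrite (_ : rel_mx j = 0) ?row0 ?sub0mx//; apply/eqP; rewrite -mxrank_eq0.
  have := rank_rel_mx j; have := ltn_expl j.+2 (ltnSn 1); move: (\rank _) => r.
  by move: (2 ^ j.+2)%N => N; nia.
move=> m M dM; have /mxrankS : (T <= M)%MS.
  apply/row_subP => i; rewrite rowE -(enum_valK i).
  have := dM (enum_val i).1 (enum_val i).2.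
  by rewrite /delta -[X in enum_rank X]surjective_pairing.
rewrite mxrank_coker; have := rkS #|Q|; rewrite expnS.
have nE : n = (#|Q| * 2)%N by rewrite card_prod card_bool.
have : (0 < 2 ^ #|Q|)%N by rewrite expn_gt0.
move: nE (rank_leq_row (S #|Q|)).
by move: #|{: _}| (\rank M) (\rank _) (2 ^ _)%N => N rM r N'; nia.
Qed.

End UniversalCocycle.

(** * The torsion group *)

Local Notation qrepr := generic_quotient.repr.

(** Positive words suffice because the relations make every element torsion. *)
Definition word_equiv (w1 w2 : seq bool) : Prop :=
  forall (Q : finGroupType) (a : bool -> Q), satisfies_relations a ->
    weval a w1 = weval a w2.

Definition word_equivb (w1 w2 : seq bool) : bool := `[< word_equiv w1 w2 >].

Lemma word_equivb_refl : reflexive word_equivb.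
Proof. by move=> w; apply/asboolP. Qed.

Lemma word_equivb_sym : symmetric word_equivb.
Proof. by move=> w1 w2; apply/asboolP/asboolP => e Q a aQ; rewrite e. Qed.

Lemma word_equivb_trans : transitive word_equivb.
Proof.
move=> w2 w1 w3 /asboolP e12 /asboolP e23; apply/asboolP => Q a aQ.
by rewrite e12// e23.
Qed.

Canonical word_equivb_rel := EquivRel word_equivb
  word_equivb_refl word_equivb_sym word_equivb_trans.

Definition torsion_group := {eq_quot word_equivb}%qT.

HB.instance Definition _ := Choice.on torsion_group.
HB.instance Definition _ := EqQuotient.on torsion_group.

Definition tg_of (w : seq bool) : torsion_group := (\pi w)%qT.

Definition tg_eval (Q : finGroupType) (a : bool -> Q) (x : torsion_group) : Q :=
  weval a (qrepr x).

Section Evaluation.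
Variables (Q : finGroupType) (a : bool -> Q).
Hypothesis relQ : satisfies_relations a.

Lemma tg_evalE w : tg_eval a (tg_of w) = weval a w.
Proof.
have : word_equivb (qrepr (tg_of w)) w by rewrite -eqmodE; apply/eqP/reprK.
by move=> /asboolP; apply.
Qed.

End Evaluation.

(** Residual finiteness, which reduces the group laws to finite groups. *)
Lemma tg_ext (x y : torsion_group) :
  (forall (Q : finGroupType) (a : bool -> Q), satisfies_relations a ->
    tg_eval a x = tg_eval a y) -> x = y.
Proof.
move=> xy; rewrite -[x]reprK -[y]reprK; apply/eqP; rewrite eqmodE.
by apply/asboolP => Q a aQ; exact: xy.
Qed.

Definition tg_mul (x y : torsion_group) := tg_of (qrepr x ++ qrepr y).
(** The representative is the root indexed by its own code, so this exponent is one less than a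
    multiple of its order. *)
Definition tg_inv (x : torsion_group) :=
  tg_of (wpow (2 ^ (pickle (qrepr x)).+2).-1 (qrepr x)).

Lemma tg_eval_mul (Q : finGroupType) (a : bool -> Q) x y :
  satisfies_relations a ->
  tg_eval a (tg_mul x y) = (tg_eval a x * tg_eval a y)%g.
Proof. by move=> aQ; rewrite tg_evalE// weval_cat. Qed.

Lemma tg_eval_torsion (Q : finGroupType) (a : bool -> Q) x :
  satisfies_relations a -> (tg_eval a x ^+ (2 ^ (pickle (qrepr x)).+2) = 1)%g.
Proof. by move=> /(_ (pickle (qrepr x))); rewrite /rel_root pickleK. Qed.

Lemma tg_eval_inv (Q : finGroupType) (a : bool -> Q) x :
  satisfies_relations a -> tg_eval a (tg_inv x) = (tg_eval a x)^-1%g.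
Proof.
move=> aQ; rewrite tg_evalE// weval_pow -/(tg_eval a x).
apply: (mulIg (tg_eval a x)).
by rewrite mulVg -expgSr prednK ?expn_gt0// tg_eval_torsion.
Qed.

Lemma tg_eval_one (Q : finGroupType) (a : bool -> Q) :
  satisfies_relations a -> tg_eval a (tg_of [::]) = 1%g.
Proof. by move=> aQ; rewrite tg_evalE// /weval big_nil. Qed.

Definition tgE := (tg_eval_mul, tg_eval_inv, tg_eval_one).

Lemma tg_mulA : associative tg_mul.
Proof. by move=> x y z; apply: tg_ext => Q a aQ; rewrite !tgE// mulgA. Qed.

Lemma tg_mul1 : left_id (tg_of [::]) tg_mul.
Proof. by move=> x; apply: tg_ext => Q a aQ; rewrite !tgE// mul1g. Qed.

Lemma tg_mulr1 : right_id (tg_of [::]) tg_mul.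
Proof. by move=> x; apply: tg_ext => Q a aQ; rewrite !tgE// mulg1. Qed.

Lemma tg_mulV : left_inverse (tg_of [::]) tg_inv tg_mul.
Proof. by move=> x; apply: tg_ext => Q a aQ; rewrite !tgE// mulVg. Qed.

Lemma tg_mulrV : right_inverse (tg_of [::]) tg_inv tg_mul.
Proof. by move=> x; apply: tg_ext => Q a aQ; rewrite !tgE// mulgV. Qed.

HB.instance Definition _ := isGroup.Build torsion_group
  tg_mulA tg_mul1 tg_mulr1 tg_mulV tg_mulrV.

Lemma tg_evalM (Q : finGroupType) (a : bool -> Q) (x y : torsion_group) :
  satisfies_relations a -> tg_eval a (x * y)%g = (tg_eval a x * tg_eval a y)%g.
Proof. exact: tg_eval_mul. Qed.

Lemma tg_torsion (x : torsion_group) : exists2 m, (0 < m)%N & (x ^+ m = 1)%g.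
Proof.
exists (2 ^ (pickle (qrepr x)).+2)%N; first by rewrite expn_gt0.
apply: tg_ext => Q a aQ; rewrite tg_eval_one// -(tg_eval_torsion x aQ).
move: (2 ^ _)%N => m; elim: m => [|m IH]; first by rewrite tg_eval_one.
by rewrite !expgS tg_evalM// IH.
Qed.

Lemma tg_of_cat w1 w2 : tg_of (w1 ++ w2) = (tg_of w1 * tg_of w2)%g.
Proof. by apply: tg_ext => Q a aQ; rewrite tg_evalM// !tg_evalE// weval_cat. Qed.

Lemma tg_fin_gen : finitely_generated torsion_group.
Proof.
exists [set tg_of [:: b] | b in [set: bool]]; split.
  exact/finite_image/finite_finset.
apply/seteqP; split=> // x _ S [subS XS].
have SM y z : S y -> S z -> S (y * z)%g.
  by have := group_closedM subS => SM /mem_set Sy /mem_set Sz; apply/set_mem/SM.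
rewrite -[x]reprK -/(tg_of _); elim: (qrepr x) => [|b w IH].
  by apply/set_mem; case: subS.
by rewrite -cat1s tg_of_cat; apply: SM => //; apply: XS; exists b.
Qed.

(** A basis element of finite order [m] would give its [m]-th power and the empty word the same
    value; so the basis is empty. *)
Lemma torsion_no_free (G : groupType) :
  (forall x : G, exists2 m, (0 < m)%N & (x ^+ m = 1)%g) ->
  no_nonabelian_free_subgroup G.
Proof.
move=> tors H _ [S [evH ev_inj ev_surj]].
have S0 s : ~ S s.
  move=> Ss; have [m m0 sm1] := tors s.
  have red k : reduced_words S (nseq k (s, false)).
    split=> [l|]; first by rewrite mem_nseq => /andP[_ /eqP ->].
    by elim: k => // -[|k]//= ->; rewrite !eqxx.
  have ev1 : word_eval (nseq m (s, false)) = 1%g.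
    by rewrite -sm1 /word_eval; elim: (m) => [|k IH];
      rewrite ?big_nil// big_cons IH expgS.
  have : nseq m (s, false) = [::].
    apply: ev_inj; rewrite ?inE; [exact: red|exact: (red 0)|].
    by rewrite ev1 /word_eval big_nil.
  by case: m m0 {sm1 ev1}.
have H1 x : H x -> x = 1%g.
  move=> /ev_surj[[|l w] [wS _] <-]; first by rewrite /word_eval big_nil.
  by case: (S0 l.1); apply: wS; rewrite inE eqxx.
by move=> x y /H1 -> /H1 ->.
Qed.

(* A cocycle killing the relators defines an extension of [Q], acting on
   [Q * 'rV_n], which is again one of the finite groups defining [word_equiv]. *)
Lemma path_sum_equiv (Q : finGroupType) (a : bool -> Q) n
    (d : Q -> bool -> 'rV['F_2]_n) (w1 w2 : seq bool) :
  satisfies_relations a ->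
  (forall g j, path_sum a d g (wpow (2 ^ j.+2) (rel_root j)) = 0) ->
  word_equiv w1 w2 -> forall g, path_sum a d g w1 = path_sum a d g w2.
Proof.
move=> aQ drel w12 g.
pose act b (z : Q * 'rV['F_2]_n) := ((z.1 * a b)%g, z.2 + d z.1 b).
have act_inj b : injective (act b).
  by move=> [h t] [h' t'] [/mulIg <- /addIr <-].
pose c b := perm (@act_inj b).
(* Permutation products apply the left factor first, so the action of [w] follows the path labelled
   [w]. *)
have cE w z : weval c w z = ((z.1 * weval a w)%g, z.2 + path_sum a d z.1 w).
  elim: w z => [|b w IH] z.
    by rewrite /weval !big_nil perm1 mulg1 addr0 -surjective_pairing.
  rewrite {1}/weval big_cons permM -/(weval c w) IH permE /act/=.
  by rewrite /weval big_cons mulgA addrA.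
have cQ : satisfies_relations c.
  move=> j; rewrite -weval_pow; apply/permP => z.
  by rewrite cE drel weval_pow aQ mulg1 addr0 perm1 -surjective_pairing.
have := congr1 (fun s : {perm _} => (s (g, 0)).2) (w12 _ _ cQ).
by rewrite !cE/= !add0r.
Qed.

(** Quotients separating the individual pairs are combined into a direct product. *)
Lemma tg_separates (s : seq (torsion_group * torsion_group)) :
  exists (Q : finGroupType) (a : bool -> Q), satisfies_relations a /\
    {in s, forall z, tg_eval a z.1 = tg_eval a z.2 -> z.1 = z.2}.
Proof.
elim: s => [|[x y] s [Q [a [aQ sep]]]].
  exists 'S_0, (fun _ => 1%g); split=> // j.
  by rewrite /weval big1// expg1n.
have [->|xy] := pselect (x = y).
  by exists Q, a; split=> // z; rewrite inE => /orP[/eqP->//|]; exact: sep.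
have [Q1 [b [bQ bxy]]] : exists (Q1 : finGroupType) (b : bool -> Q1),
    satisfies_relations b /\ tg_eval b x <> tg_eval b y.
  apply: contrapT => nosep; apply: xy; apply: tg_ext => Q1 b bQ.
  by apply: contrapT => bxy; apply: nosep; exists Q1, b.
pose c i : Q1 * Q := (b i, a i).
have cE w : weval c w = (weval b w, weval a w).
  by rewrite /weval; elim: w => [|i w IH]; rewrite ?big_nil// !big_cons IH.
exists (Q1 * Q)%type, c; split.
  move=> j; rewrite -weval_pow cE !weval_pow.
  by rewrite (bQ j) (aQ j).
move=> z; rewrite inE /tg_eval !cE => /orP[/eqP -> /= [] //|zs [_]].
exact: sep.
Qed.

Lemma tg_overlap_le (R : realFieldType) (A : seq torsion_group)
    (X : set torsion_group) (f : torsion_group -> R) :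
  uniq A -> finite_set X -> generates X -> (forall y, 0 <= f y) ->
  exists2 x, X x & \sum_(y <- A | (y * x)%g \in A) Num.min (f y) (f (y * x)%g)
                     <= 2 / 3 * \sum_(y <- A) f y.
Proof.
move=> uniqA finX genX f0.
have [Q [a [aQ sep]]] := tg_separates [seq (x, y) | x <- A, y <- A].
have [d [drel drk]] := universal_cocycle aQ.
(* The path sum is independent of the representative, so the cocycle descends to the group. *)
have PE g w : path_sum a d g (qrepr (tg_of w)) = path_sum a d g w.
  apply: path_sum_equiv => // Q' a' aQ'; exact: tg_evalE.
apply: (@overlap_le R _ Q (tg_eval a) 'F_2 _
  (fun g x => path_sum a d g (qrepr x)) A X f) => //.
- by move=> x y; exact: tg_evalM.
- by move=> g x y; rewrite PE path_sum_cat.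
- move=> m M PM; apply: drk => g b.
  by have := PM g (tg_of [:: b]); rewrite PE /= addr0.
- move=> x y xA yA; apply: (sep (x, y)).
  by apply/allpairsP; exists (x, y).
Qed.

(** * From overlaps to unit vectors *)

Section SquareSummable.
Variables (R : realType) (G : groupType).
Implicit Types (v : G -> R[i]) (s : seq G).

Local Notation nsq z := (ComplexField.Normc.normc z ^+ 2).

Lemma l2_sum_le v s : L2 v -> uniq s ->
  \sum_(g <- s) nsq (v g) <= fine (l2sqnorm v).
Proof.
move=> v2 us; rewrite -lee_fin fineK; last first.
  by rewrite ge0_fin_numE ?esum_ge0// => g _; rewrite lee_fin sqr_ge0.
apply: esum_ge; exists [set` s]; first by split=> //; exact: finite_seq.
by rewrite -fsbig_seq// sumEFin.
Qed.

Lemma l2_adherent v c : c < fine (l2sqnorm v) ->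
  exists2 s, uniq s & c < \sum_(g <- s) nsq (v g).
Proof.
move=> cv; have : (c%:E < l2sqnorm v)%E.
  move: cv; case E : (l2sqnorm v) => [r| |] //= _; first exact: ltry.
  have : (0 <= l2sqnorm v)%E by apply: esum_ge0 => g _; rewrite lee_fin sqr_ge0.
  by rewrite E.
move=> /ereal_sup_gt[_ [X [finX _] <-]]; rewrite fsbig_finite//= sumEFin lte_fin.
by exists (finmap.enum_fset (fset_set X)) => //; exact: finmap.fset_uniq.
Qed.

Lemma l2_bounded v C : (forall s, uniq s -> \sum_(g <- s) nsq (v g) <= C) -> L2 v.
Proof.
move=> vC; rewrite /L2/=; apply: (@le_lt_trans _ _ C%:E); last exact: ltry.
apply: ge_ereal_sup => _ [X [finX _] <-].
rewrite fsbig_finite//= sumEFin lee_fin; apply: vC; exact: finmap.fset_uniq.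
Qed.

Lemma ler_normcD (z w : R[i]) : ComplexField.Normc.normc (z + w) <=
  ComplexField.Normc.normc z + ComplexField.Normc.normc w.
Proof. exact: le_normcD. Qed.

Lemma normc_opp (z : R[i]) :
  ComplexField.Normc.normc (- z) = ComplexField.Normc.normc z.
Proof. exact: normcN. Qed.

Lemma normc_ge0 (z : R[i]) : 0 <= ComplexField.Normc.normc z.
Proof. by case: z => x y; exact: sqrtr_ge0. Qed.

Lemma nsq_sub_ge (z w : R[i]) :
  (ComplexField.Normc.normc z - ComplexField.Normc.normc w) ^+ 2 <= nsq (z - w).
Proof.
have := ler_normcD (z - w) w; have := ler_normcD (w - z) z.
rewrite !subrK -(opprB z w) normc_opp => h1 h2.
by rewrite -[leLHS]real_normK ?num_real// ler_sqr ?nnegrE ?normc_ge0// ler_norml; lra.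
Qed.

Lemma nsq_sub_le (z w : R[i]) : nsq (z - w) <= 2 * nsq z + 2 * nsq w.
Proof.
have := ler_normcD z (- w); rewrite normc_opp => zw.
apply: (@le_trans _ _ ((ComplexField.Normc.normc z + ComplexField.Normc.normc w) ^+ 2)).
  by rewrite ler_sqr ?nnegrE ?addr_ge0 ?normc_ge0.
have := sqr_ge0 (ComplexField.Normc.normc z - ComplexField.Normc.normc w); nra.
Qed.

Lemma L2_lreg_sub v x : L2 v -> L2 (fun g => lreg x v g - v g).
Proof.
move=> v2; apply: (@l2_bounded _ (2 * fine (l2sqnorm v) + 2 * fine (l2sqnorm v))).
move=> s us; apply: le_trans (ler_sum _ (fun g _ => nsq_sub_le _ _)) _.
rewrite big_split/= -!mulr_sumr lerD// ler_wpM2l// ?l2_sum_le//.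
rewrite /lreg -(big_map (fun g => x^-1 * g)%g predT (fun g => nsq (v g))).
by apply: l2_sum_le => //; rewrite map_inj_uniq//; exact: mulgI.
Qed.

End SquareSummable.

Lemma big_seq_subset (V : nmodType) (T : eqType) (A B : seq T) (F : T -> V) :
  uniq A -> uniq B -> {subset A <= B} ->
  \sum_(y <- B | y \in A) F y = \sum_(y <- A) F y.
Proof.
move=> uA uB AB; rewrite -big_filter; apply: perm_big; apply: uniq_perm => //.
  exact: filter_uniq.
by move=> y; rewrite mem_filter andb_idr//; exact: AB.
Qed.

(** With both flags true this is a positive definite form, as [13/6 * 25/6 > 3^2]. A false flag,
    marking a point outside [A], is paid for by the corresponding correction term. *)
Lemma sqr_sub_min_ge (R : realFieldType) (a b : R) (P Q : bool) :
  5 / 6 * (a ^+ 2 + b ^+ 2)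
    - 2 * (if P && Q then Num.min (a ^+ 2) (b ^+ 2) else 0)
    - 2 * (a ^+ 2 - (if P then a ^+ 2 else 0))
    - 2 * (b ^+ 2 - (if Q then b ^+ 2 else 0)) <= 3 * (a - b) ^+ 2.
Proof.
have h : 5 / 6 * (a ^+ 2 + b ^+ 2) - 2 * Num.min (a ^+ 2) (b ^+ 2)
    <= 3 * (a - b) ^+ 2.
  have := sqr_ge0 (5 * a - 7 * b); have := sqr_ge0 (7 * a - 5 * b).
  by case: (leP (a ^+ 2) (b ^+ 2)) => ab; nra.
have := sqr_ge0 a; have := sqr_ge0 b; have := sqr_ge0 (a - b).
have : Num.min (a ^+ 2) (b ^+ 2) <= a ^+ 2 by rewrite ge_min lexx.
have : Num.min (a ^+ 2) (b ^+ 2) <= b ^+ 2 by rewrite ge_min lexx orbT.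
by case: P; case: Q => /=; lra.
Qed.

Lemma overlap_moves_by (R : realType) (G : groupType) (X : set G) :
  (forall (A : seq G) (f : G -> R), uniq A -> (forall y, 0 <= f y) ->
     exists2 x, X x &
       \sum_(y <- A | (y * x)%g \in A) Num.min (f y) (f (y * x)%g)
         <= 2 / 3 * \sum_(y <- A) f y) ->
  moves_by X (1 / 4 : R).
Proof.
move=> overlap v v2 v1.
have v1' : fine (l2sqnorm v) = 1.
  have fv0 : 0 <= fine (l2sqnorm v).
    by apply/fine_ge0/esum_ge0 => g _; rewrite lee_fin sqr_ge0.
  by rewrite -(sqr_sqrtr fv0) -/(l2norm v) v1 expr1n.
have [s us sv] : exists2 s, uniq s &
    99 / 100 < \sum_(g <- s) ComplexField.Normc.normc (v g) ^+ 2.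
  by apply: l2_adherent; rewrite v1'; lra.
(* Inversion turns left translation into right multiplication by [x]. *)
pose a y := ComplexField.Normc.normc (v y^-1%g).
pose f y := a y ^+ 2.
pose A := [seq y^-1%g | y <- s].
have uA : uniq A by rewrite map_inj_uniq//; exact: invg_inj.
have f0 y : 0 <= f y by exact: sqr_ge0.
have [x Xx ovx] := overlap A f uA f0; exists x => //.
set S := \sum_(y <- A) f y in ovx; set m := \sum_(y <- A | _) _ in ovx.
have S99 : 99 / 100 < S.
  rewrite /S big_map; apply: lt_le_trans sv _.
  by apply: ler_sum => y _; rewrite /f /a invgK.
have sum_le1 B : uniq B -> \sum_(y <- B) f y <= 1.
  move=> uB; rewrite -v1' /f /a.
  rewrite -(big_map (fun y => y^-1)%g predT
    (fun g => ComplexField.Normc.normc (v g) ^+ 2)).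
  by apply: l2_sum_le => //; rewrite map_inj_uniq//; exact: invg_inj.
(* [B] contains every [y] with [y] or [y * x] in [A], so both sums over [B] recover [S]. *)
pose B := undup (A ++ [seq (y * x^-1)%g | y <- A]).
have uB : uniq B by exact: undup_uniq.
have AB : {subset A <= B} by move=> y yA; rewrite mem_undup mem_cat yA.
pose Bx := [seq (y * x)%g | y <- B].
have uBx : uniq Bx by rewrite map_inj_uniq//; exact: mulIg.
have ABx : {subset A <= Bx}.
  move=> y yA; apply/mapP; exists (y * x^-1)%g; last by rewrite mulgKV.
  rewrite mem_undup mem_cat; apply/orP; right.
  by apply/mapP; exists y.
have SB : \sum_(y <- B) (if y \in A then f y else 0) = S.
  by rewrite -big_mkcond big_seq_subset.
have SBx : \sum_(y <- B) (if (y * x)%g \in A then f (y * x)%g else 0) = S.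
  rewrite -(big_map (fun y => y * x)%g predT (fun z => if z \in A then f z else 0)).
  by rewrite -big_mkcond big_seq_subset.
have mB : \sum_(y <- B) (if (y \in A) && ((y * x)%g \in A)
    then Num.min (f y) (f (y * x)%g) else 0) = m.
  by rewrite -big_mkcond big_mkcondr big_seq_subset// -big_mkcond.
have Sb := sum_le1 _ uB; have Sbx : \sum_(y <- B) f (y * x)%g <= 1.
  by rewrite -(big_map (fun y => y * x)%g predT f); exact: sum_le1.
pose w := fun g => lreg x v g - v g.
have wL2 : L2 w by exact: L2_lreg_sub.
have wB : \sum_(y <- B) (a y - a (y * x)%g) ^+ 2 <= fine (l2sqnorm w).
  have uB' : uniq [seq y^-1%g | y <- B] by rewrite map_inj_uniq//; exact: invg_inj.
  apply: le_trans (l2_sum_le wL2 uB'); rewrite big_map; apply: ler_sum => y _.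
  apply: le_trans (nsq_sub_ge _ _); rewrite /w /lreg /a invgM -opprB sqrrN.
  exact: lexx.
have : 1 / 16 <= fine (l2sqnorm w).
  apply: le_trans wB.
  (* Since both sums of [f] are at most 1 and [m <= 2/3 * S], the sum is at least [8/3 * S - 7/3],
     which exceeds [3/16] for [S > 99/100]. *)
  suff : 3 / 16 <= \sum_(y <- B) 3 * (a y - a (y * x)%g) ^+ 2.
    by rewrite -mulr_sumr; lra.
  apply: le_trans (ler_sum _ (fun y _ =>
    sqr_sub_min_ge (a y) (a (y * x)%g) (y \in A) ((y * x)%g \in A))).
  rewrite !sumrB -!mulr_sumr !sumrB big_split/= SB SBx mB.
  have S_le : S <= \sum_(y <- B) f y.
    by rewrite -SB; apply: ler_sum => y _; case: ifP.
  have Sx_le : S <= \sum_(y <- B) f (y * x)%g.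
    by rewrite -SBx; apply: ler_sum => y _; case: ifP.
  rewrite -/(\sum_(y <- B) f y) -/(\sum_(y <- B) f (y * x)%g); lra.
move=> /ler_wsqrtr; apply: le_trans.
rewrite (_ : 1 / 16 = (1 / 4) ^+ 2 :> R); last by lra.
by rewrite sqrtr_sqr ger0_norm//; lra.
Qed.

Theorem corollary1p4 (R : realType) :
  exists G : groupType,
    [/\ finitely_generated G,
        uniformly_nonamenable R G &
        no_nonabelian_free_subgroup G].
Proof.
exists torsion_group; split; first exact: tg_fin_gen; last first.
  exact/torsion_no_free/tg_torsion.
apply: (@lt_le_trans _ _ (1 / 4)); first lra.
(* The bound [1/4] is the same for all [X], so it passes to the infimum, taken over a nonempty
   set. *)
apply: lb_le_inf.
  by have [X genX] := tg_fin_gen; exists (alphaX R X), X.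
move=> _ [X [finX genX] <-].
have mvX : moves_by X (1 / 4 : R).
  by apply: overlap_moves_by => A f uA f0; exact: tg_overlap_le.
have X0 : X !=set0.
  by have [v v2 v1] := L2_unit_vector R torsion_group;
    have [x Xx _] := mvX v v2 v1; exists x.
by have [_ _ alpha_max] := alphaX_max R finX X0; apply: alpha_max => //; lra.
Qed.
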